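(* Let $w_1,w_2,w_3$ be any odd positive integers and let $n\ge 0$ be an integer. Then \begin{align*} &\sum_{k+l+m=n}\binom{n}{k,l,m}T_{k,q^{w_3}}(w_1-1)T_{l,q^{w_1}}(w_2-1)T_{m,q^{w_2}}(w_3-1)\,w_3^{k}w_1^{l}w_2^{m}\\ =&\sum_{k+l+m=n}\binom{n}{k,l,m}T_{k,q^{w_2}}(w_1-1)T_{l,q^{w_1}}(w_3-1)T_{m,q^{w_3}}(w_2-1)\,w_2^{k}w_1^{l}w_3^{m}. \end{align*}
   Context: Let $p$ be a fixed odd prime, $\mathbb{C}_p$ the completion of an algebraic closure of $\mathbb{Q}_p$ with absolute value normalized by $|p|_p=1/p$, and let $q\in\mathbb{C}_p$ be fixed with $|q-1|_p<p^{-1/(p-1)}$. For $r=q^w$ ($w$ a positive integer) and integers $k,N\ge 0$, the $r$-analogue of the alternating power sum is $T_{k,r}(N)=\sum_{i=0}^{N}(-1)^i i^k r^i$, with the convention $0^0=1$. Sums over $k+l+m=n$ run over all nonnegative integers $k,l,m$ with $k+l+m=n$, and $\binom{n}{k,l,m}=\frac{n!}{k!\,l!\,m!}$. *)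

(* Defs.v *)
From HB Require Import structures.
From mathcomp Require Export all_boot all_order all_algebra.
From mathcomp Require Export reals exp.

Set Implicit Arguments.
Unset Strict Implicit.
Unset Printing Implicit Defensive.

Import Order.TTheory GRing.Theory Num.Theory.

Local Open Scope ring_scope.

Section AbsoluteValues.
Variable R : realType.

Definition is_absval (K : fieldType) (v : K -> R) : Prop :=
  [/\ forall x, 0 <= v x,
      forall x, v x = 0 <-> x = 0,
      forall x y, v (x * y) = v x * v y
    & forall x y, v (x + y) <= v x + v y].

Definition absval_cauchy (K : fieldType) (v : K -> R) (u : nat -> K) : Prop :=
  forall e : R, 0 < e -> exists N : nat,
    forall m n : nat, (N <= m)%N -> (N <= n)%N -> v (u m - u n) < e.

Definition absval_cvg (K : fieldType) (v : K -> R) (u : nat -> K) (l : K) :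
    Prop :=
  forall e : R, 0 < e -> exists N : nat,
    forall n : nat, (N <= n)%N -> v (u n - l) < e.

Definition absval_complete (K : fieldType) (v : K -> R) : Prop :=
  forall u : nat -> K, absval_cauchy v u -> exists l : K, absval_cvg v u l.

(* (L, w), together with the embedding f, is a completion of (K, v); it is
   unique up to a unique isometric isomorphism under K. *)
Definition is_completion (K : fieldType) (v : K -> R)
    (L : fieldType) (w : L -> R) (f : {rmorphism K -> L}) : Prop :=
  [/\ is_absval w,
      forall x, w (f x) = v x,
      forall (y : L) (e : R), 0 < e -> exists x : K, w (y - f x) < e
    & absval_complete w].

(* v_p(x) = logn p |numq x| - logn p |denq x|, and |x|_p = p ^ (- v_p(x)). *)
Definition padic_abs (p : nat) (x : rat) : R :=
  if x == 0 then 0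
  else p%:R ^+ logn p `|denq x|%N / p%:R ^+ logn p `|numq x|%N.

End AbsoluteValues.

Definition is_alg_closure (K L : fieldType) (f : {rmorphism K -> L}) : Prop :=
  GRing.closed_field_axiom L /\ forall x : L, algebraicOver f x.

(* (C, v) is the completion of an algebraic closure A of Q_p, where Q_p is the
   completion of rat for the p-adic absolute value and A carries the (unique)
   absolute value extending that of Q_p.  This determines (C, v) up to
   isometric isomorphism. *)
Definition is_Cp (R : realType) (p : nat) (C : fieldType) (v : C -> R) : Prop :=
  exists (Qp : fieldType) (vQp : Qp -> R) (iQ : {rmorphism rat -> Qp})
         (A : fieldType) (vA : A -> R) (iA : {rmorphism Qp -> A})
         (iC : {rmorphism A -> C}),
    [/\ is_completion (padic_abs R p) vQp iQ,
        is_alg_closure iA,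
        is_absval vA /\ (forall x, vA (iA x) = vQp x)
      & is_completion vA v iC].

Lemma is_Cp_abs_p (R : realType) (p : nat) (C : fieldType) (v : C -> R) :
  prime p -> is_Cp p v -> v p%:R = p%:R^-1.
Proof.
move=> p_pr [Qp [vQ [iQ [A [vA [iA [iC [[_ hQ _ _] _ [_ hA] [_ hC _ _]]]]]]]]].
rewrite -(rmorph_nat iC) hC -(rmorph_nat iA) hA -(rmorph_nat iQ) hQ.
rewrite /padic_abs pnatr_eq0 gtn_eqF ?prime_gt0 //=.
rewrite (_ : p%:R = p%:Z%:~R :> rat) // numq_int denq_int /=.
by rewrite logn1 logn_prime // eqxx expr0 expr1 div1r.
Qed.

(* T_{k,r}(N); x ^+ 0 = 1 for every x, hence the convention 0^0 = 1. *)
Definition Tsum (K : pzRingType) (k : nat) (r : K) (N : nat) : K :=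
  \sum_(i < N.+1) (-1) ^+ i * i%:R ^+ k * r ^+ i.

(* The division is exact when k + l + m = n, the only case it is used in. *)
Definition trinomial (n k l m : nat) : nat := (n`! %/ (k`! * l`! * m`!))%N.

(* Main.v *)
(** Expanding the power sums and applying the trinomial theorem, the left-hand
    side is the sum of the terms [(-1)^(i+j+s) q^e e^n], where
    [e = w3 i + w1 j + w2 s] and [i < w1], [j < w2], [s < w3].  It is thus the
    value at [q] of [(X d/dX)^n] applied to the product of the three geometric
    sums of [- X^w3], [- X^w1], [- X^w2] of lengths [w1], [w2], [w3].  As the
    [wi] are odd, this product times [(1 + X^w1) (1 + X^w2) (1 + X^w3)] is
    [(1 + X^(w1 w2)) (1 + X^(w2 w3)) (1 + X^(w3 w1))], which is symmetric in the
    [wi]; the monic factor cancels. *)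

From HB Require Import structures.
Require Import Defs.
From mathcomp Require Import all_boot all_order all_algebra reals exp.
From mathcomp Require Import ring.

Set Implicit Arguments.
Unset Strict Implicit.
Unset Printing Implicit Defensive.

Import Order.TTheory GRing.Theory Num.Theory.

Local Open Scope ring_scope.

Lemma trinomialE (n k l : nat) : (k + l <= n)%N ->
  trinomial n k l (n - k - l) = ('C(n, k) * 'C(n - k, l))%N.
Proof.
move=> le_kl.
have le_k : (k <= n)%N := leq_trans (leq_addr l k) le_kl.
have le_l : (l <= n - k)%N by rewrite leq_subRL.
rewrite /trinomial -(bin_fact le_k) -(bin_fact le_l).
rewrite (_ : _ * _ = 'C(n, k) * 'C(n - k, l) * (k`! * l`! * (n - k - l)`!))%N;
  last by rewrite !mulnA; congr (_ * _)%N; rewrite -!mulnA;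
          congr (_ * _)%N; rewrite mulnCA mulnA.
by rewrite mulnK // !muln_gt0 !fact_gt0.
Qed.

(** Two applications of the binomial theorem: split off [a], then [b]; the exponent of [c] is forced
    to be [n - k - l]. *)
Lemma exprD3n (A : comPzRingType) (a b c : A) (n : nat) :
  (a + b + c) ^+ n =
  \sum_(k < n.+1) \sum_(l < n.+1) \sum_(m < n.+1 | (k + l + m == n)%N)
     (trinomial n k l m)%:R * (a ^+ k * b ^+ l * c ^+ m).
Proof.
rewrite -addrA addrC exprDn; apply: eq_bigr => k _.
have le_k : (k <= n)%N by rewrite -ltnS.
rewrite addrC exprDn mulr_suml -sumrMnl.
(* The inner sum stops at [n - k]. It is widened to [n] under a guard; where the guard fails, no [m]
   satisfies [k + l + m = n]. *)
rewrite (big_ord_widen n.+1 (fun l : nat =>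
  (c ^+ (n - k - l) * b ^+ l *+ 'C(n - k, l)) * a ^+ k *+ 'C(n, k)));
  last by rewrite ltnS leq_subr.
rewrite big_mkcond; apply: eq_bigr => l _.
rewrite ltnS leq_subRL //; case: ifPn => [le_kl | nle_kl].
  have lt_m : (n - k - l < n.+1)%N by rewrite ltnS -subnDA leq_subr.
  rewrite (big_pred1 (Ordinal lt_m)) => [|m] /=; last first.
    by rewrite -val_eqE /= -subnDA -[RHS](eqn_add2l (k + l)) subnKC.
  by rewrite trinomialE //; ring.
rewrite big_pred0 // => m; apply: contraNF nle_kl => /eqP e_n.
by rewrite -[leqRHS]e_n leq_addr.
Qed.

(** The weights enter the power sums by [TsumM], so for fixed [i], [j], [s] the sum over [k], [l],
    [m] is a trinomial expansion. *)
Lemma trinomial_Tsum (A : comPzRingType) (r1 r2 r3 a b c : A)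
    (N1 N2 N3 n : nat) :
  \sum_(k < n.+1) \sum_(l < n.+1) \sum_(m < n.+1 | (k + l + m == n)%N)
     (trinomial n k l m)%:R * Tsum k r1 N1 * Tsum l r2 N2 * Tsum m r3 N3
     * a ^+ k * b ^+ l * c ^+ m
  = \sum_(i < N1.+1) \sum_(j < N2.+1) \sum_(s < N3.+1)
      (- r1) ^+ i * (- r2) ^+ j * (- r3) ^+ s
      * (i%:R * a + j%:R * b + s%:R * c) ^+ n.
Proof.
have TsumM k (r x : A) N :
    Tsum k r N * x ^+ k = \sum_(i < N.+1) (- r) ^+ i * (i%:R * x) ^+ k.
  rewrite /Tsum mulr_suml; apply: eq_bigr => i _.
  by rewrite [(- r) ^+ i]exprNn exprMn; ring.
(* Expand the [n]-th power, then carry the sums over [k], [l], [m] outward past those over [s], [j]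
   and [i] in turn. *)
under [RHS]eq_bigr => i _.
  under eq_bigr => j _.
    under eq_bigr => s _.
      rewrite exprD3n mulr_sumr.
      under eq_bigr => k _.
        rewrite mulr_sumr; under eq_bigr => l _ do rewrite mulr_sumr.
        over.
      over.
    rewrite exchange_big /=.
    under eq_bigr => k _.
      rewrite exchange_big /=; under eq_bigr => l _ do rewrite exchange_big /=.
      over.
    over.
  rewrite exchange_big /=.
  under eq_bigr => k _.
    rewrite exchange_big /=; under eq_bigr => l _ do rewrite exchange_big /=.
    over.
  over.
rewrite [RHS]exchange_big /=; apply: eq_bigr => k _.
rewrite [RHS]exchange_big /=; apply: eq_bigr => l _.
rewrite [RHS]exchange_big /=; apply: eq_bigr => m _.
transitivity ((trinomial n k l m)%:R * ((Tsum k r1 N1 * a ^+ k) *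
    ((Tsum l r2 N2 * b ^+ l) * (Tsum m r3 N3 * c ^+ m)))); first by ring.
rewrite !TsumM mulr_suml mulr_sumr; apply: eq_bigr => i _.
rewrite mulr_suml !mulr_sumr; apply: eq_bigr => j _.
by rewrite !mulr_sumr; apply: eq_bigr => s _; ring.
Qed.

Section EulerOperator.
Variable A : comNzRingType.

Definition euler_op (f : {poly A}) : {poly A} := 'X * f^`().

Lemma euler_op_is_linear : linear euler_op.
Proof.
by move=> a f g; rewrite /euler_op linearP /= mulrDr scalerAr.
Qed.

HB.instance Definition _ :=
  GRing.isLinear.Build A {poly A} {poly A} _ euler_op euler_op_is_linear.

Lemma iter_euler_op_sum n (I : Type) (s : seq I) (F : I -> {poly A}) :
  iter n euler_op (\sum_(i <- s) F i) = \sum_(i <- s) iter n euler_op (F i).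
Proof. by elim: n => //= n ->; rewrite linear_sum. Qed.

Lemma iter_euler_opZXn n (a : A) e :
  iter n euler_op (a *: 'X^e) = (a * e%:R ^+ n) *: 'X^e.
Proof.
elim: n => [|n IHn] /=; first by rewrite expr0 mulr1.
rewrite IHn linearZ /= /euler_op derivXn exprS.
(* For [e = 0] the truncated exponent [e.-1] does not give back ['X^e], but the factor [e] makes
   both sides vanish. *)
case: e {IHn} => [|e].
  by rewrite mulr0n mulr0 scaler0 mul0r mulr0 scale0r.
by rewrite mulrnAr -exprS -scaler_nat scalerA; congr (_ *: _); ring.
Qed.

(** The sum telescopes, and oddness of [w] turns [(- 'X^d) ^+ w] into [- 'X^(w * d)]. *)
Lemma mul_geom_oddXn (w d : nat) : odd w ->
  (1 + 'X^d) * \sum_(i < w) (- 'X^d) ^+ i = 1 + 'X^(w * d) :> {poly A}.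
Proof.
move=> w_odd; have := subrX1 (- 'X^d : {poly A}) w.
rewrite exprNn -signr_odd w_odd expr1 mulN1r -exprM mulnC => e.
by apply: oppr_inj; rewrite -mulNr !opprD ![- 1 - _]addrC e.
Qed.

Definition geom3 (w1 w2 w3 a b c : nat) : {poly A} :=
  (\sum_(i < w1) (- 'X^a) ^+ i) * ((\sum_(j < w2) (- 'X^b) ^+ j)
  * (\sum_(s < w3) (- 'X^c) ^+ s)).

Lemma geom3_sym (w1 w2 w3 : nat) : odd w1 -> odd w2 -> odd w3 ->
  geom3 w1 w2 w3 w3 w1 w2 = geom3 w1 w3 w2 w2 w1 w3.
Proof.
move=> o1 o2 o3.
have lreg1X w : odd w -> GRing.lreg (1 + 'X^w : {poly A}).
  (* Since [w > 0], the polynomial is monic, hence cancellable even if [A] has zero divisors. *)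
  move=> w_odd; apply: lreg_lead; rewrite addrC -[1]opprK -polyCN.
  by rewrite lead_coefXnsubC ?odd_gt0 //; apply: lreg1.
apply/(lreg1X _ o1)/(lreg1X _ o2)/(lreg1X _ o3); rewrite /geom3.
have G w d (o : odd w) := mul_geom_oddXn d o.
(* Each factor [1 + 'X^d] is paired with the geometric sum of step [d]. The two sides pair
   differently but yield the same three exponents. *)
transitivity ((1 + 'X^(w1 * w3)) * (1 + 'X^(w2 * w1)) * (1 + 'X^(w3 * w2))
  : {poly A}); first by rewrite -!G //; ring.
rewrite (mulnC w1 w3) (mulnC w2 w1) (mulnC w3 w2) -!G //; ring.
Qed.

(** Each triple of indices gives a signed monomial, an eigenvector of [euler_op] whose eigenvalue is
    its exponent. *)
Lemma sum3_euler_geom3 (q : A) (w1 w2 w3 a b c n : nat) :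
  \sum_(i < w1) \sum_(j < w2) \sum_(s < w3)
    (- q ^+ a) ^+ i * (- q ^+ b) ^+ j * (- q ^+ c) ^+ s
    * (i%:R * a%:R + j%:R * b%:R + s%:R * c%:R) ^+ n
  = (iter n euler_op (geom3 w1 w2 w3 a b c)).[q].
Proof.
rewrite /geom3 mulr_suml iter_euler_op_sum horner_sum.
apply: eq_bigr => i _; rewrite mulr_suml mulr_sumr iter_euler_op_sum horner_sum.
apply: eq_bigr => j _; rewrite !mulr_sumr iter_euler_op_sum horner_sum.
apply: eq_bigr => s _.
have -> : (- 'X^a) ^+ i * ((- 'X^b) ^+ j * (- 'X^c) ^+ s)
    = (-1) ^+ (i + j + s) *: 'X^(a * i + b * j + c * s) :> {poly A}.
  rewrite (exprNn 'X^a) (exprNn 'X^b) (exprNn 'X^c) -!exprM !exprD.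
  by rewrite -mul_polyC !rmorphM !rmorphXn /= polyCN; ring.
rewrite iter_euler_opZXn hornerZ hornerXn !natrD !natrM.
(* Once the products are reordered, the [n]-th powers on both sides coincide and can be abstracted;
   only signs and powers of [q] remain. *)
rewrite (mulrC a%:R) (mulrC b%:R) (mulrC c%:R); move: (_ ^+ n) => x.
rewrite (exprNn (q ^+ a)) (exprNn (q ^+ b)) (exprNn (q ^+ c)).
by rewrite -!exprM !exprD; ring.
Qed.

End EulerOperator.

Theorem theorem4p17 (R : realType) (p : nat) (p_pr : prime p) (p_odd : odd p)
    (Cp : fieldType) (absp : Cp -> R) (hCp : is_Cp p absp)
    (q : Cp) (hq : absp (q - 1) < p%:R `^ (- (p%:R - 1)^-1))
    (w1 w2 w3 : nat) (w1_odd : odd w1) (w2_odd : odd w2) (w3_odd : odd w3)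
    (n : nat) :
  \sum_(k < n.+1) \sum_(l < n.+1) \sum_(m < n.+1 | (k + l + m == n)%N)
     (trinomial n k l m)%:R
     * Tsum k (q ^+ w3) (w1 - 1) * Tsum l (q ^+ w1) (w2 - 1)
     * Tsum m (q ^+ w2) (w3 - 1)
     * w3%:R ^+ k * w1%:R ^+ l * w2%:R ^+ m
  = \sum_(k < n.+1) \sum_(l < n.+1) \sum_(m < n.+1 | (k + l + m == n)%N)
     (trinomial n k l m)%:R
     * Tsum k (q ^+ w2) (w1 - 1) * Tsum l (q ^+ w1) (w3 - 1)
     * Tsum m (q ^+ w3) (w2 - 1)
     * w2%:R ^+ k * w1%:R ^+ l * w3%:R ^+ m.
Proof.
(* Oddness makes [w] positive, so the truncated [w - 1] is exact and each power sum has [w]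
   terms. *)
have sub1K w : odd w -> (w - 1).+1 = w
  by move=> /odd_gt0; rewrite subn1 => /prednK.
rewrite !trinomial_Tsum !sub1K // !sum3_euler_geom3.
by rewrite geom3_sym.
Qed.
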